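(* Let $d\ge1$. There exists a positive constant $C_d$ depending on $d$ alone such that for every compact set $S\subseteq\mathbb{R}^d$ and $0<\eta\le\frac{2\sqrt{2\pi}}{(2\pi)^{d/2}\sqrt e}$, we have $$\log N(\eta,\mathcal{M},\|\cdot\|_S)\le C_d\,N(a,S^a)\,|\log\eta|^{d+1}$$ and $$\log N(\eta,\mathcal{M},\|\cdot\|_{S,\nabla})\le C_d\,N(a,S^a)\,|\log\eta|^{d+1},$$ where $a$ is defined as $$a:=\sqrt{2\log\frac{2\sqrt{2\pi}}{(2\pi)^{d/2}\eta}}.$$
   Context: $\|\cdot\|$ is the Euclidean norm and $\phi_d(z):=(2\pi)^{-d/2}\exp(-\|z\|^2/2)$. For a probability measure $G$ on $\mathbb{R}^d$, $f_G(x):=\int\phi_d(x-\theta)\,dG(\theta)$, and $\mathcal{M}$ is the class of all $f_G$ as $G$ ranges over all probability measures on $\mathbb{R}^d$. For compact $S\subseteq\mathbb{R}^d$, define the pseudonorms $\|f\|_S:=\sup_{x\in S}|f(x)|$ and $\|f\|_{S,\nabla}:=\sup_{x\in S}\|\nabla f(x)\|$; these induce pseudometrics $\varrho(f,g)=\|f-g\|_S$ and $\varrho(f,g)=\|f-g\|_{S,\nabla}$ on $\mathcal{M}$. For such a pseudometric, the $\eta$-covering number (written $N(\eta,\mathcal{M},\|\cdot\|_S)$, resp. $N(\eta,\mathcal{M},\|\cdot\|_{S,\nabla})$) is the smallest positive integer $N$ for which there exist $f_1,\dots,f_N\in\mathcal{M}$ with $\sup_{f\in\mathcal{M}}\inf_{1\le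 i\le N}\varrho(f,f_i)\le\eta$. For $a>0$, $S^a:=\{x\in\mathbb{R}^d:\inf_{u\in S}\|x-u\|\le a\}$, and $N(a,S^a)$ is the Euclidean $a$-covering number of $S^a$, i.e. the smallest number of closed balls of radius $a$ whose union contains $S^a$. *)

(* Defs.v *)
From HB Require Import structures.
From mathcomp Require Import all_boot all_order all_algebra.
From mathcomp Require Import all_classical all_reals all_analysis.

Set Implicit Arguments.
Unset Strict Implicit.
Unset Printing Implicit Defensive.

Import Order.TTheory GRing.Theory Num.Theory.
Import numFieldNormedType.Exports.

Local Open Scope classical_set_scope.
Local Open Scope ring_scope.

(* The library norm on 'rV[R]_d is the sup norm; it induces the usual topology
   (open, compact, derivatives), but metric notions need the Euclidean norm. *)
Definition enorm (R : realType) (d : nat) (x : 'rV[R]_d) : R :=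
  Num.sqrt (\sum_(i < d) x 0 i ^+ 2).

(* R^d with its Borel sigma-algebra. *)
Definition borelRd (R : realType) (d : nat) :=
  g_sigma_algebraType (@open 'rV[R]_d).

Definition gauss_density (R : realType) (d : nat) (z : 'rV[R]_d) : R :=
  (2 * pi) `^ (- (d%:R / 2)) * expR (- (enorm z ^+ 2 / 2)).

Definition gauss_mixture (R : realType) (d : nat)
    (G : probability (borelRd R d) R) (x : 'rV[R]_d) : R :=
  \int[G]_(theta in [set: borelRd R d])
     gauss_density (x - (theta : 'rV[R]_d)).

Definition mixtures (R : realType) (d : nat) : set ('rV[R]_d -> R) :=
  [set f | exists G : probability (borelRd R d) R, f = gauss_mixture G].
Arguments mixtures : clear implicits.

Definition gradient (R : realType) (d : nat) (f : 'rV[R]_d -> R)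
    (x : 'rV[R]_d) : 'rV[R]_d :=
  \row_(i < d) 'D_(delta_mx 0 i) f x.

(* Suprema of nonnegative quantities, taken in [0, +oo]: adjoining 0 only
   matters for S empty, where the pseudonorms are then 0 instead of -oo. *)
Definition supnorm (R : realType) (d : nat) (S : set 'rV[R]_d)
    (f : 'rV[R]_d -> R) : \bar R :=
  ereal_sup (0%E |` [set `|f x|%:E | x in S]).

Definition grad_supnorm (R : realType) (d : nat) (S : set 'rV[R]_d)
    (f : 'rV[R]_d -> R) : \bar R :=
  ereal_sup (0%E |` [set (enorm (gradient f x))%:E | x in S]).

(* The least element of A, or +oo if A is empty. *)
Definition least (R : realType) (A : set nat) : \bar R :=
  ereal_inf [set (n%:R : R)%:E | n in A].

Definition covering_number (R : realType) (T : Type) (eta : R) (M : set T)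
    (rho : T -> T -> \bar R) : \bar R :=
  least R [set N | (0 < N)%N /\
    exists c : 'I_N -> T, (forall i, M (c i)) /\
      (ereal_sup [set ereal_inf [set rho f (c i) | i in [set: 'I_N]] | f in M]
        <= eta%:E)%E].

Definition closed_eball (R : realType) (d : nat) (c : 'rV[R]_d) (r : R) :
    set 'rV[R]_d :=
  [set x | enorm (x - c) <= r].

Definition euclidean_covering_number (R : realType) (d : nat) (a : R)
    (A : set 'rV[R]_d) : \bar R :=
  least R [set N | exists c : 'I_N -> 'rV[R]_d,
    A `<=` \bigcup_(i in [set: 'I_N]) closed_eball (c i) a].

(* The infimum is extended-valued so that enlarging the empty set gives the
   empty set. *)
Definition enlargement (R : realType) (d : nat) (S : set 'rV[R]_d) (a : R) :
    set 'rV[R]_d :=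
  [set x | (ereal_inf [set (enorm (x - u))%:E | u in S] <= a%:E)%E].

(* Main.v *)
Require Import Defs.
From HB Require Import structures.
From mathcomp Require Import all_boot all_order all_algebra.
From mathcomp Require Import all_classical all_reals all_analysis.
From mathcomp Require Import measurable_realfun.
From mathcomp Require Import ring lra.

(** The covering number is bounded by a pigeonhole argument on finitely many
    Gaussian-weighted moments of the mixing measure.

    Let c_1, ..., c_N be centers of balls of radius a covering S, and put
    b = 4 d a.  For x within a of c = c_i, write u = x - c and v = theta - c.
    The Gaussian density factors as
      phi(u - v) = (2 pi)^(-d/2) e^(-|u|^2/2) e^(-|v|^2/2) prod_l e^(u_l v_l).
    If |v| <= b, each e^(u_l v_l) is the sum of the first K terms of its
    exponential series, up to an error e^(4ab - K); the product of these sums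
    is a finite combination, with coefficients depending on u alone, of
    monomials in v.  If |v| > b, then theta is far from x and phi(x - theta)
    is negligible.  Hence f_G near c is determined, up to a small error, by
    the integrals against G of e^(-|v|^2/2) times monomials of degree < K in
    each v_l, restricted to the ball of radius b about c.  Since
    D_l phi(x - theta) = - (u_l - v_l) phi(x - theta), the gradient is
    determined in the same way once the same integrals with one more factor
    v_l are included.  This is [kernel_approx] with [kernel_approx_far],
    integrated in [Rintegral_diff_le].

    With monomials taken in v / b all these moments lie in [-b, b].  Cut that
    interval into bins of width delta.  Two measures whose moments lie in the
    same bins have mixtures within eta of each other in both pseudonorms
    ([moment_code_pseudonorms]), so the covering number is at most the number
    of bin patterns ([covering_number_le_code]); each center is a mixture
    realizing its pattern.  There are N (d+1) K^d moments, and the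
    coefficients of the combination are bounded by e^(O(ab)).  As
    ab = O(a^2) = O(|log eta|), it suffices to take K = O(|log eta|) and
    log(1/delta) = O(|log eta|), whence a log-number of patterns of order
    N K^d |log eta| = O(N |log eta|^(d+1)) ([entropy_le]).

    These estimates need |log eta| bounded below.  They are used for
    eta < 3/4; the constraint on eta excludes eta >= 3/4 unless d = 1, and
    then one mixture covers the whole class ([entropy_dim1_le0]). *)

Set Implicit Arguments.
Unset Strict Implicit.
Unset Printing Implicit Defensive.

Import Order.TTheory GRing.Theory Num.Theory.
Import numFieldNormedType.Exports.

Local Open Scope classical_set_scope.
Local Open Scope ring_scope.

(** * Truncated exponential series and products *)

Definition expR_trunc (R : realType) (K : nat) (t : R) : R :=
  \sum_(n < K) t ^+ n / n`!%:R.

Lemma expR_truncE (R : realType) (K : nat) (t : R) :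
  expR_trunc K t = series (exp_coeff t) K.
Proof. by rewrite /series /= big_mkord. Qed.

Lemma cvg_expR_trunc (R : realType) (t : R) :
  expR_trunc n t @[n --> \oo] --> expR t.
Proof.
have -> : (fun n => expR_trunc n t) = series (exp_coeff t).
  by apply/funext => n; exact: expR_truncE.
exact: is_cvg_series_exp_coeff.
Qed.

Lemma expR_trunc_le (R : realType) (K : nat) (t : R) :
  0 <= t -> expR_trunc K t <= expR t.
Proof.
move=> t0; rewrite expR_truncE; apply: nondecreasing_cvgn_le.
  by apply: nondecreasing_series => n _ _; exact: exp_coeff_ge0.
exact: is_cvg_series_exp_coeff.
Qed.

Lemma normr_expR_trunc (R : realType) (K : nat) (t T : R) :
  `|t| <= T -> `|expR_trunc K t| <= expR T.
Proof.
move=> tT; apply: (le_trans (ler_norm_sum _ _ _)).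
apply: le_trans (_ : expR_trunc K `|t| <= _); last first.
  by apply: (le_trans (expR_trunc_le _ _)); rewrite ?ler_expR.
by apply: ler_sum => n _; rewrite normrM normrX normfV normr_nat.
Qed.

Lemma expR1_le4 (R : realType) : expR 1 <= 4 :> R.
Proof.
have h := expR_ge1Dx (- 2^-1 : R).
have -> : 1 = - ((- 2^-1) * 2%:R) :> R by field.
rewrite expRN expRM_natr -[leRHS]invrK lef_pV2 ?posrE ?exprn_gt0 ?expR_gt0//.
apply: le_trans (_ : (2^-1)^+2 <= _); first by lra.
by rewrite ler_pXn2r// ?nnegrE ?expR_ge0//; lra.
Qed.

(** The tail of the series at t is at most e^(-K) times a part of the series
    at e |t|, because e^(n - K) >= 1 for n >= K.  The constant 4 bounds e. *)
Lemma expR_trunc_error (R : realType) (K : nat) (t T : R) :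
  `|t| <= T -> `|expR t - expR_trunc K t| <= expR (4 * T - K%:R).
Proof.
move=> tT; have T0 : 0 <= T by exact: le_trans tT.
pose e : R := expR 1; have e1 : 1 <= e by rewrite -[leLHS]expR0 ler_expR.
have e0 : 0 < e by exact: expR_gt0.
have cvgd : `|expR_trunc n t - expR_trunc K t| @[n --> \oo]
    --> `|expR t - expR_trunc K t|.
  by apply: cvg_norm; apply: cvgB; [exact: cvg_expR_trunc|exact: cvg_cst].
apply: (cvgr_to_le cvgd); near=> n.
have Kn : (K <= n)%N by near: n; exact: nbhs_infty_ge.
rewrite /expR_trunc -!(big_mkord xpredT (fun n => t ^+ n / n`!%:R)).
rewrite (big_cat_nat (n := K))//= addrAC subrr add0r.
apply: (le_trans (ler_norm_sum _ _ _)).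
apply: (@le_trans _ _ (e ^- K * \sum_(K <= i < n) (e * T) ^+ i / i`!%:R)).
  rewrite mulr_sumr big_nat [leRHS]big_nat; apply: ler_sum => i /andP[Ki _].
  rewrite normrM normrX normfV normr_nat mulrA ler_wpM2r ?invr_ge0//.
  (* Here K <= i, so e^(i - K) >= 1. *)
  rewrite exprMn mulrA; apply: (@le_trans _ _ (1 * T ^+ i)).
    by rewrite mul1r lerXn2r ?nnegrE.
  rewrite ler_wpM2r ?exprn_ge0//.
  by rewrite mulrC ler_pdivlMr ?exprn_gt0// mul1r ler_weXn2l.
rewrite expRD expRN -[K%:R]mul1r expRM_natr -/e mulrC.
rewrite ler_wpM2r ?invr_ge0 ?exprn_ge0 ?(ltW e0)//.
apply: (@le_trans _ _ (expR_trunc n (e * T))).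
  rewrite /expR_trunc -(big_mkord xpredT (fun n => (e * T) ^+ n / n`!%:R)).
  rewrite [leRHS](big_cat_nat (n := K))//= lerDr sumr_ge0// => i _.
  by rewrite divr_ge0// exprn_ge0// mulr_ge0// ltW.
apply: le_trans (expR_trunc_le _ _) _; first by rewrite mulr_ge0// ltW.
by rewrite ler_expR ler_wpM2r// expR1_le4.
Unshelve. all: by end_near. Qed.

Lemma normr_prod_le (R : realType) (I : Type) (r : seq I) (A : I -> R) (M : R) :
  (forall i, `|A i| <= M) -> `|\prod_(i <- r) A i| <= M ^+ size r.
Proof.
move=> AM; elim: r => [|i r ih]; first by rewrite big_nil expr0 normr1.
by rewrite big_cons normrM exprS ler_pM.
Qed.

(** Replace the factors one at a time: each replacement costs at most e times
    a product of factors bounded by M. *)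
Lemma normr_prodB_le (R : realType) (I : Type) (r : seq I) (A B : I -> R)
    (M e : R) :
  1 <= M -> (forall i, `|A i| <= M) -> (forall i, `|B i| <= M) ->
  (forall i, `|A i - B i| <= e) ->
  `|\prod_(i <- r) A i - \prod_(i <- r) B i| <= (size r)%:R * (M ^+ size r * e).
Proof.
move=> M1 AM BM ABe; elim: r => [|i r ih].
  by rewrite !big_nil subrr normr0 mul0r.
have e0 : 0 <= e by exact: le_trans (ABe i).
have M0 : 0 <= M by rewrite (le_trans _ M1).
rewrite !big_cons; set a := \prod_(j <- r) A j; set b := \prod_(j <- r) B j.
have -> : A i * a - B i * b = A i * (a - b) + (A i - B i) * b by ring.
apply: (le_trans (ler_normD _ _)); rewrite !normrM /= -natr1 mulrDl mul1r.
apply: lerD.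
  apply: (@le_trans _ _ (M * ((size r)%:R * (M ^+ size r * e)))).
    by rewrite ler_pM.
  by rewrite exprS le_eqVlt; apply/orP; left; apply/eqP; ring.
rewrite mulrC ler_pM//; apply: (le_trans (normr_prod_le _ BM)).
by rewrite exprS ler_peMl// exprn_ge0.
Qed.

(** * The Gaussian kernel and its partial derivatives *)

Definition gauss_const (R : realType) (d : nat) : R :=
  (2 * pi) `^ (- (d%:R / 2)).

(** The density (index None) and its d partial derivatives (index Some l) are
    all a polynomial of degree at most one times the density.  Treating them
    as one family lets a single moment argument control both pseudonorms. *)
Definition gauss_weight (R : realType) (d : nat) (o : option 'I_d)
    (z : 'rV[R]_d) : R :=
  if o is Some l then - z 0 l else 1.

Definition gauss_kernel (R : realType) (d : nat) (o : option 'I_d)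
    (z : 'rV[R]_d) : R :=
  gauss_weight o z * gauss_density z.

Lemma expRN_sqr_le1 (R : realType) (x r : R) :
  0 <= r -> expR (- (x ^+ 2 / r)) <= 1.
Proof.
by move=> r0; rewrite -[leRHS]expR0 ler_expR oppr_le0 divr_ge0// sqr_ge0.
Qed.

Lemma sqrt_2pi_ge2 (R : realType) : 2 <= Num.sqrt (2 * pi) :> R.
Proof.
have p4 : 4 <= 2 * pi :> R by have := pi_ge2 R; lra.
rewrite -(@ler_pXn2r _ 2)// ?nnegrE ?sqrtr_ge0// sqr_sqrtr; last lra.
by rewrite expr2; lra.
Qed.

Lemma gauss_const_gt0 (R : realType) (d : nat) : 0 < gauss_const R d.
Proof. by rewrite powR_gt0// mulr_gt0// pi_gt0. Qed.

Lemma gauss_const_ge0 (R : realType) (d : nat) : 0 <= gauss_const R d.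
Proof. exact/ltW/gauss_const_gt0. Qed.

Lemma gauss_const_le (R : realType) (d : nat) :
  (1 <= d)%N -> gauss_const R d <= 2^-1.
Proof.
move=> d1; have p4 : 4 <= 2 * pi :> R by have := pi_ge2 R; lra.
have p0 : 0 < 2 * pi :> R by lra.
rewrite /gauss_const powRN lef_pV2 ?posrE ?powR_gt0//.
apply: (@le_trans _ _ ((2 * pi) `^ (2^-1))).
  by rewrite powR12_sqrt ?(ltW p0)// sqrt_2pi_ge2.
by rewrite ler_powR//; [lra|rewrite ler_pdivlMr// mulVf// ler1n].
Qed.

Lemma enorm_ge0 (R : realType) (d : nat) (z : 'rV[R]_d) : 0 <= enorm z.
Proof. exact: sqrtr_ge0. Qed.

Lemma sqr_enorm (R : realType) (d : nat) (z : 'rV[R]_d) :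
  enorm z ^+ 2 = \sum_(i < d) z 0 i ^+ 2.
Proof. by rewrite sqr_sqrtr// sumr_ge0// => i _; exact: sqr_ge0. Qed.

Lemma coord_le_enorm (R : realType) (d : nat) (z : 'rV[R]_d) (i : 'I_d) :
  `|z 0 i| <= enorm z.
Proof.
rewrite -(@ler_pXn2r _ 2)// ?nnegrE ?enorm_ge0// sqr_enorm (bigD1 i)//=.
by rewrite real_normK ?num_real// lerDl sumr_ge0// => j _; exact: sqr_ge0.
Qed.

Lemma enorm_le_sum (R : realType) (d : nat) (z : 'rV[R]_d) :
  enorm z <= \sum_(i < d) `|z 0 i|.
Proof.
have s0 : 0 <= \sum_(i < d) `|z 0 i| by exact: sumr_ge0.
rewrite -(@ler_pXn2r _ 2)// ?nnegrE ?enorm_ge0// sqr_enorm [leRHS]expr2 mulr_sumr.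
apply: ler_sum => i _; rewrite -real_normK ?num_real// expr2 ler_wpM2r//.
by rewrite (bigD1 i)//= lerDl sumr_ge0.
Qed.

(** A point far from a center is far from every point near it.  The squared
    form follows from (2 s - t)^2 >= 0 for the coordinates s of u and t of v. *)
Lemma sqr_enormB_ge (R : realType) (d : nat) (u v : 'rV[R]_d) :
  enorm v ^+ 2 / 2 - enorm u ^+ 2 <= enorm (u - v) ^+ 2.
Proof.
rewrite lerBlDr !sqr_enorm mulr_suml -big_split /=.
apply: ler_sum => i _; rewrite !mxE.
have := sqr_ge0 (2 * u 0 i - v 0 i); nra.
Qed.

(** Half of the Gaussian exponent absorbs the linear factor:
    t <= 1 + t^2/4 <= e^(t^2/4). *)
Lemma normr_gauss_kernel (R : realType) (d : nat) (o : option 'I_d)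
    (z : 'rV[R]_d) :
  `|gauss_kernel o z| <= gauss_const R d * expR (- (enorm z ^+ 2 / 4)).
Proof.
rewrite /gauss_kernel /gauss_density -/(gauss_const R d) mulrCA normrM.
rewrite ger0_norm ?gauss_const_ge0//.
rewrite ler_wpM2l ?gauss_const_ge0// normrM [`|expR _|]ger0_norm ?expR_ge0//.
have -> : - (enorm z ^+ 2 / 4) = enorm z ^+ 2 / 4 - enorm z ^+ 2 / 2 by field.
rewrite expRD ler_wpM2r ?expR_ge0//.
case: o => [l|] /=; last first.
  by rewrite normr1 -[leLHS]expR0 ler_expR divr_ge0// sqr_ge0.
rewrite normrN; apply: (le_trans _ (expR_ge1Dx _)).
have := coord_le_enorm z l; have := normr_ge0 (z 0 l).
have := sqr_ge0 (enorm z - 2); nra.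
Qed.

Lemma normr_gauss_kernel_le (R : realType) (d : nat) (o : option 'I_d)
    (z : 'rV[R]_d) :
  `|gauss_kernel o z| <= gauss_const R d.
Proof.
apply: (le_trans (normr_gauss_kernel _ _)).
by rewrite ger_pMr ?gauss_const_gt0// expRN_sqr_le1.
Qed.

(** The constant is chosen so that, for d = 1, the gradients of two mixtures
    are within 3/4 of each other; it follows from
    4t/3 <= 1 + t^2/2 <= e^(t^2/2). *)
Lemma normr_gauss_kernel_Some (R : realType) (d : nat) (l : 'I_d)
    (z : 'rV[R]_d) :
  `|gauss_kernel (Some l) z| <= 3 / 4 * gauss_const R d.
Proof.
rewrite /gauss_kernel /gauss_density -/(gauss_const R d) mulrCA normrM mulrC.
rewrite [`|gauss_const _ _|]ger0_norm ?gauss_const_ge0//.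
rewrite ler_wpM2r ?gauss_const_ge0//.
rewrite normrM [`|expR _|]ger0_norm ?expR_ge0//= normrN expRN.
rewrite ler_pdivrMr ?expR_gt0//.
apply: (le_trans (coord_le_enorm _ _)).
have := expR_ge1Dx (enorm z ^+ 2 / 2).
have := sqr_ge0 (enorm z - 4/3); nra.
Qed.

(** * Finite-rank approximation of the kernel *)

Definition monom (R : realType) (d K : nat) (al : {ffun 'I_d -> 'I_K})
    (z : 'rV[R]_d) : R := \prod_(l < d) z 0 l ^+ al l.

(** The functions whose integrals form the moment vector.  The factor
    [gauss_weight] supplies the extra v_l needed for the gradient, and the
    scaling by b keeps the monomials in [-1, 1] on the ball. *)
Definition moment_fun (R : realType) (d K : nat) (c : 'rV[R]_d) (b : R)
    (p : option 'I_d * {ffun 'I_d -> 'I_K}) (theta : 'rV[R]_d) : R :=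
  \1_(closed_eball c b) theta *
  (gauss_weight p.1 (theta - c) * expR (- (enorm (theta - c) ^+ 2 / 2)) *
   monom p.2 (b^-1 *: (theta - c))).

(** Coefficients of [gauss_weight o (u - v)] on the family
    [gauss_weight _ v]; see [gauss_weightB]. *)
Definition weight_coef (R : realType) (d : nat) (o q : option 'I_d)
    (u : 'rV[R]_d) : R :=
  match o, q with
  | None, None => 1
  | None, Some _ => 0
  | Some l, None => - u 0 l
  | Some l, Some l' => - (l' == l)%:R
  end.

Definition kernel_coef (R : realType) (d K : nat) (o : option 'I_d)
    (b : R) (p : option 'I_d * {ffun 'I_d -> 'I_K}) (u : 'rV[R]_d) : R :=
  weight_coef o p.1 u * (gauss_const R d * expR (- (enorm u ^+ 2 / 2))) *
  \prod_(l < d) ((u 0 l * b) ^+ p.2 l / (p.2 l)`!%:R).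

Lemma gauss_factor_le1 (R : realType) (d : nat) (u : 'rV[R]_d) :
  (1 <= d)%N -> `|gauss_const R d * expR (- (enorm u ^+ 2 / 2))| <= 1.
Proof.
move=> d1; rewrite ger0_norm ?mulr_ge0 ?gauss_const_ge0 ?expR_ge0//.
rewrite -[leRHS]mulr1 ler_pM ?gauss_const_ge0 ?expR_ge0 ?expRN_sqr_le1//.
by have := gauss_const_le R d1; lra.
Qed.

Lemma big_option (R : realType) (d : nat) (F : option 'I_d -> R) :
  \sum_o F o = F None + \sum_(l < d) F (Some l).
Proof.
rewrite (bigD1 None)//=; congr (_ + _).
rewrite (reindex_omap (@Some _) id)//=; last by case.
by apply: eq_bigl => l; rewrite eqxx.
Qed.

Lemma gauss_weightB (R : realType) (d : nat) (o : option 'I_d)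
    (u v : 'rV[R]_d) :
  gauss_weight o (u - v) = \sum_q weight_coef o q u * gauss_weight q v.
Proof.
rewrite big_option; case: o => [l|] /=; last first.
  by rewrite big1 ?addr0 ?mulr1// => i _; rewrite mul0r.
rewrite (bigD1 l)//= big1 ?addr0; last first.
  by move=> i /negbTE ->; rewrite oppr0 mul0r.
by rewrite eqxx !mxE mulr1 mulN1r opprD opprK.
Qed.

Lemma gauss_densityB (R : realType) (d : nat) (u v : 'rV[R]_d) :
  gauss_density (u - v) =
  (gauss_const R d * expR (- (enorm u ^+ 2 / 2))) * expR (- (enorm v ^+ 2 / 2))
  * \prod_(l < d) expR (u 0 l * v 0 l).
Proof.
rewrite -expR_sum -(mulrA (gauss_const R d)) -expRD -(mulrA (gauss_const R d)).
rewrite -expRD /gauss_density; congr (_ * expR _).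
rewrite !sqr_enorm !mulr_suml -!sumrN -!big_split/=.
by apply: eq_bigr => l _; rewrite !mxE; field.
Qed.

(** Dividing v by b and multiplying u by b leaves the products u_l v_l
    unchanged, and turns the expansion into one over normalized monomials. *)
Lemma prod_expR_trunc (R : realType) (d K : nat) (b : R) (u v : 'rV[R]_d) :
  b != 0 ->
  \prod_(l < d) expR_trunc K (u 0 l * v 0 l) =
  \sum_(al : {ffun 'I_d -> 'I_K})
     (\prod_(l < d) ((u 0 l * b) ^+ al l / (al l)`!%:R)) * monom al (b^-1 *: v).
Proof.
move=> b0; rewrite bigA_distr_bigA /=; apply: eq_bigr => al _.
rewrite -big_split /=; apply: eq_bigr => l _; rewrite !mxE.
rewrite mulrAC -exprMn; congr (_ ^+ _ / _); by field.
Qed.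

(** On the ball of radius b, the exact kernel and its approximation differ
    only in the factors e^(u_l v_l), each replaced by a partial sum; the other
    factors contribute at most a + b. *)
Lemma kernel_approx (R : realType) (d K : nat) (o : option 'I_d) (a b : R)
    (c x theta : 'rV[R]_d) :
  (1 <= d)%N -> 1 <= a -> 1 <= b ->
  enorm (x - c) <= a -> enorm (theta - c) <= b ->
  `|gauss_kernel o (x - theta) -
    \sum_(p : option 'I_d * {ffun 'I_d -> 'I_K})
      kernel_coef o b p (x - c) * moment_fun c b p theta| <=
  (a + b) * (d%:R * (expR (a * b) ^+ d * expR (4 * (a * b) - K%:R))).
Proof.
move=> d1 a1 b1; set u := x - c; set v := theta - c => ua vb.
have a0 : 0 < a by lra.
have b0 : 0 < b by lra.
have -> : x - theta = u - v by rewrite /u /v opprB addrA subrK.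
set g := gauss_const R d * expR (- (enorm u ^+ 2 / 2)).
set h := expR (- (enorm v ^+ 2 / 2)).
have -> : \sum_(p : option 'I_d * {ffun 'I_d -> 'I_K})
      kernel_coef o b p u * moment_fun c b p theta =
    gauss_weight o (u - v) * (g * h) * \prod_(l < d) expR_trunc K (u 0 l * v 0 l).
  rewrite (prod_expR_trunc _ _ _ (lt0r_neq0 b0)).
  rewrite gauss_weightB mulr_suml big_distrlr /= pair_big /=.
  apply: eq_bigr => -[q al] _ /=.
  rewrite /kernel_coef /moment_fun /= -/u -/v -/g -/h indicE mem_set//=.
  by rewrite mul1r; ring.
rewrite /gauss_kernel gauss_densityB -/g -/h mulrA -mulrBr normrM.
have uv l : `|u 0 l * v 0 l| <= a * b.
  rewrite normrM ler_pM//.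
    exact: le_trans (coord_le_enorm _ _) ua.
  exact: le_trans (coord_le_enorm _ _) vb.
have gh : `|g * h| <= 1.
  rewrite normrM -[leRHS]mulr1 ler_pM ?gauss_factor_le1//.
  by rewrite ger0_norm ?expR_ge0// expRN_sqr_le1.
apply: ler_pM => //.
  rewrite normrM -[leRHS]mulr1 ler_pM//.
  case: (o) => [l|] /=; last by rewrite normr1; lra.
  have -> : (u - v) 0 l = u 0 l - v 0 l by rewrite !mxE.
  rewrite normrN (le_trans (ler_normB _ _))// lerD//.
    exact: le_trans (coord_le_enorm _ _) ua.
  exact: le_trans (coord_le_enorm _ _) vb.
have := @normr_prodB_le _ _ (index_enum 'I_d) (fun l => expR (u 0 l * v 0 l))
  (fun l => expR_trunc K (u 0 l * v 0 l)) (expR (a * b)) (expR (4 * (a * b) - K%:R)).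
rewrite [in size _]/index_enum; case: index_enum_key => /=.
rewrite -enumT size_enum_ord; apply.
- by rewrite -[leLHS]expR0 ler_expR mulr_ge0// ltW.
- move=> l; rewrite ger0_norm ?expR_ge0// ler_expR.
  exact: le_trans (ler_norm _) (uv l).
- by move=> l; exact: normr_expR_trunc.
- by move=> l; exact: expR_trunc_error.
Qed.

(** Outside the ball the approximation vanishes and theta is at distance at
    least sqrt(b^2/2 - a^2) from x, so the decay of the kernel suffices. *)
Lemma kernel_approx_far (R : realType) (d K : nat) (o : option 'I_d) (a b : R)
    (c x theta : 'rV[R]_d) :
  enorm (x - c) <= a -> 0 <= b -> b < enorm (theta - c) ->
  `|gauss_kernel o (x - theta) -
    \sum_(p : option 'I_d * {ffun 'I_d -> 'I_K})
      kernel_coef o b p (x - c) * moment_fun c b p theta| <=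
  gauss_const R d * expR (- ((b ^+ 2 / 2 - a ^+ 2) / 4)).
Proof.
move=> xa b0 bt; rewrite big1 ?subr0; last first.
  move=> p _; rewrite /moment_fun indicE memNset ?mul0r ?mulr0//.
  by rewrite /closed_eball /= leNgt bt.
apply: (le_trans (normr_gauss_kernel _ _)).
rewrite ler_wpM2l ?gauss_const_ge0// ler_expR lerN2 ler_wpM2r//.
have -> : x - theta = (x - c) - (theta - c).
  by rewrite opprB addrA subrK.
apply: (le_trans _ (sqr_enormB_ge _ _)).
have := enorm_ge0 (x - c).
have := enorm_ge0 (theta - c).
by nra.
Qed.

(** The sum over multi-indices factors into d truncated exponential series
    with nonnegative terms.  The bound may be exponential in ab: it only
    enters the logarithm of the bin width. *)
Lemma sum_kernel_coef (R : realType) (d K : nat) (o : option 'I_d) (a b : R)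
    (u : 'rV[R]_d) :
  (1 <= d)%N -> 1 <= a -> 1 <= b -> enorm u <= a ->
  \sum_(p : option 'I_d * {ffun 'I_d -> 'I_K}) `|kernel_coef o b p u| <=
  (a + 1) * expR (a * b) ^+ d.
Proof.
move=> d1 a1 b1 ua.
set g := gauss_const R d * expR (- (enorm u ^+ 2 / 2)).
have g1 : `|g| <= 1 by exact: gauss_factor_le1.
have -> : \sum_(p : option 'I_d * {ffun 'I_d -> 'I_K}) `|kernel_coef o b p u| =
   (\sum_q `|weight_coef o q u * g|) *
   \prod_(l < d) expR_trunc K (`|u 0 l| * b).
  rewrite bigA_distr_bigA /= big_distrlr pair_big /=.
  apply: eq_bigr => -[q al] _ /=.
  rewrite /kernel_coef normrM -/g; congr (_ * _).
  rewrite normr_prod; apply: eq_bigr => l _.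
  by rewrite normrM normrX normrM normfV normr_nat (@ger0_norm _ b)//; lra.
have un l : 0 <= `|u 0 l| * b by rewrite mulr_ge0//; lra.
have ul l : `|u 0 l| * b <= a * b.
  by rewrite ler_wpM2r//; [lra|exact: le_trans (coord_le_enorm _ _) ua].
apply: ler_pM.
- by apply: sumr_ge0.
- apply: prodr_ge0 => l _; apply: sumr_ge0 => i _.
  by rewrite divr_ge0// exprn_ge0.
- apply: (@le_trans _ _ (\sum_q `|weight_coef o q u|)).
    by apply: ler_sum => q _; rewrite normrM ler_piMr.
  rewrite big_option; case: o => [l|] /=; last first.
    by rewrite normr1 big1 ?addr0; [lra|move=> i _; rewrite normr0].
  rewrite (bigD1 l)//= big1 ?addr0; last first.
    by move=> i /negbTE ->; rewrite oppr0 normr0.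
  by rewrite eqxx !normrN normr1 lerD2r (le_trans (coord_le_enorm _ _) ua).
- have -> : expR (a * b) ^+ d = \prod_(l < d) expR (a * b).
    by rewrite prodr_const card_ord.
  apply: ler_prod => l _; apply/andP; split.
    apply: sumr_ge0 => i _; by rewrite divr_ge0// exprn_ge0.
  by apply: (le_trans (expR_trunc_le _ _)) => //; rewrite ler_expR.
Qed.

Lemma normr_moment_fun (R : realType) (d K : nat) (c : 'rV[R]_d) (b : R)
    (p : option 'I_d * {ffun 'I_d -> 'I_K}) (theta : 'rV[R]_d) :
  1 <= b -> `|moment_fun c b p theta| <= b.
Proof.
move=> b1; rewrite /moment_fun indicE.
have [|_] := boolP (theta \in closed_eball c b); last first.
  by rewrite mul0r normr0; lra.
rewrite inE /closed_eball /= mul1r => tb.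
rewrite -[leRHS]mulr1 normrM ler_pM//.
  rewrite -[leRHS]mulr1 normrM ler_pM//.
    case: p.1 => [l|] /=; last by rewrite normr1.
    by rewrite normrN (le_trans (coord_le_enorm _ _)).
  by rewrite ger0_norm ?expR_ge0// expRN_sqr_le1.
rewrite normr_prod prodr_ile1// => l _; rewrite normr_ge0/= normrX exprn_ile1//.
rewrite !mxE mulrC normrM normfV (@ger0_norm _ b); last lra.
rewrite ler_pdivrMr; last lra.
by rewrite mul1r; have := coord_le_enorm (theta - c) l; rewrite !mxE; lra.
Qed.

(** * Integration against a mixing measure *)

Lemma measurable_continuous_borelRd (R : realType) (d : nat)
    (f : 'rV[R]_d -> R) :
  continuous f -> measurable_fun [set: borelRd R d] (f : borelRd R d -> R).
Proof.
move=> /continuousP cf; apply: (measurability _ (RGenOpens.measurableE R)).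
move=> _ [_ [a [b ->] <-]]; rewrite setTI.
by apply: sub_sigma_algebra; exact/cf/interval_open.
Qed.

Lemma measurable_coord (R : realType) (d : nat) (l : 'I_d) :
  measurable_fun [set: borelRd R d] (fun t : borelRd R d => (t : 'rV[R]_d) 0 l).
Proof. by apply: measurable_continuous_borelRd; exact: coord_continuous. Qed.

Lemma measurable_comp_affine (R : realType) (d : nat) (l : 'I_d) (r : R)
    (c : 'rV[R]_d) :
  measurable_fun [set: borelRd R d]
    (fun t : borelRd R d => (c + r *: (t : 'rV[R]_d)) 0 l).
Proof.
under eq_fun do rewrite !mxE.
apply: measurable_funD => //; apply: measurable_funM => //.
exact: measurable_coord.
Qed.

Lemma measurable_enorm (R : realType) (d : nat) (f : borelRd R d -> 'rV[R]_d) :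
  (forall l, measurable_fun [set: borelRd R d] (fun t => f t 0 l)) ->
  measurable_fun [set: borelRd R d] (fun t => enorm (f t)).
Proof.
move=> mf; have ms : measurable_fun [set: R] (@Num.sqrt R).
  by apply: continuous_measurable_fun; exact: sqrt_continuous.
rewrite /enorm; apply: (measurableT_comp ms).
by apply: measurable_sum => l; exact: measurable_funX.
Qed.

Lemma measurable_gauss_weight (R : realType) (d : nat) (o : option 'I_d)
    (f : borelRd R d -> 'rV[R]_d) :
  (forall l, measurable_fun [set: borelRd R d] (fun t => f t 0 l)) ->
  measurable_fun [set: borelRd R d] (fun t => gauss_weight o (f t)).
Proof.
by move=> mf; case: o => [l|] //=; exact: measurable_funN.
Qed.

Lemma measurable_expR_enorm (R : realType) (d : nat)
    (f : borelRd R d -> 'rV[R]_d) :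
  (forall l, measurable_fun [set: borelRd R d] (fun t => f t 0 l)) ->
  measurable_fun [set: borelRd R d] (fun t => expR (- (enorm (f t) ^+ 2 / 2))).
Proof.
move=> mf; apply: measurableT_comp => //; apply: measurable_funN.
apply: measurable_funM => //; apply: measurable_funX.
exact: measurable_enorm.
Qed.

Lemma measurable_gauss_kernel (R : realType) (d : nat) (o : option 'I_d)
    (x : 'rV[R]_d) :
  measurable_fun [set: borelRd R d]
    (fun t : borelRd R d => gauss_kernel o (x - (t : 'rV[R]_d))).
Proof.
have mf l : measurable_fun [set: borelRd R d]
    (fun t : borelRd R d => (x - (t : 'rV[R]_d)) 0 l).
  under eq_fun do rewrite -scaleN1r; exact: measurable_comp_affine.
apply: measurable_funM; first exact: measurable_gauss_weight.
by apply: measurable_funM => //; exact: measurable_expR_enorm.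
Qed.

Lemma measurable_moment_fun (R : realType) (d K : nat) (c : 'rV[R]_d) (b : R)
    (p : option 'I_d * {ffun 'I_d -> 'I_K}) :
  measurable_fun [set: borelRd R d]
    (fun t : borelRd R d => moment_fun c b p (t : 'rV[R]_d)).
Proof.
have mf l : measurable_fun [set: borelRd R d]
    (fun t : borelRd R d => ((t : 'rV[R]_d) - c) 0 l).
  under eq_fun do rewrite addrC -[X in _ + X]scale1r.
  exact: measurable_comp_affine.
apply: measurable_funM.
  apply: measurable_indic; rewrite -[X in measurable X]setTI.
  by apply: measurable_fun_le => //; exact: measurable_enorm.
apply: measurable_funM.
  apply: measurable_funM; first exact: measurable_gauss_weight.
  exact: measurable_expR_enorm.
apply: measurable_prod => l _; apply: measurable_funX.
under eq_fun do rewrite mxE; apply: measurable_funM => //; exact: mf.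
Qed.

Lemma bounded_integrable (R : realType) (disp : measure_display)
    (T : measurableType disp) (G : probability T R) (f : T -> R) (M : R) :
  measurable_fun [set: T] f -> (forall t, `|f t| <= M) ->
  G.-integrable [set: T] (EFin \o f).
Proof.
move=> mf fM; apply: measurable_bounded_integrable => //.
  exact: (le_lt_trans (probability_le1 _ _) (ltry 1)).
exists M; split; first exact: num_real.
by move=> x Mx t _ /=; exact: le_trans (fM t) (ltW Mx).
Qed.

Lemma normr_Rintegral_le (R : realType) (disp : measure_display)
    (T : measurableType disp) (G : probability T R) (f : T -> R) (M : R) :
  measurable_fun [set: T] f -> (forall t, `|f t| <= M) ->
  `|\int[G]_(t in [set: T]) f t| <= M.
Proof.
move=> mf fM; have intf := bounded_integrable G mf fM.
apply: (le_trans (le_normr_Rintegral measurableT intf)).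
rewrite [leRHS](_ : _ = \int[G]_(t in [set: T]) M).
  apply: le_Rintegral => //.
    apply: (@bounded_integrable _ _ _ _ _ M); first exact: measurableT_comp.
    by move=> t; rewrite normr_id.
  by apply: (@bounded_integrable _ _ _ _ _ `|M|).
by rewrite Rintegral_cst// [X in fine X]probability_setT mulr1.
Qed.

Lemma Rintegral_lincomb (R : realType) (disp : measure_display)
    (T : measurableType disp) (G : probability T R) (I : Type) (s : seq I)
    (k : I -> R) (f : I -> T -> R) :
  (forall i, G.-integrable [set: T] (EFin \o f i)) ->
  G.-integrable [set: T] (EFin \o (fun t => \sum_(i <- s) k i * f i t)) /\
  \int[G]_(t in [set: T]) (\sum_(i <- s) k i * f i t) =
  \sum_(i <- s) k i * \int[G]_(t in [set: T]) f i t.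
Proof.
move=> intf.
have intk i : G.-integrable [set: T] (EFin \o (fun t => k i * f i t)).
  exact: (integrableZl measurableT (k i) (intf i)).
elim: s => [|i s [ih1 ih2]].
  split; first by rewrite /comp /=; under eq_fun do rewrite big_nil;
    exact: integrable0.
  under eq_Rintegral do rewrite big_nil.
  by rewrite Rintegral_cst// mul0r big_nil.
split.
  rewrite /comp /=; under eq_fun do rewrite big_cons EFinD.
  exact: (integrableD measurableT (intk i) ih1).
under eq_Rintegral do rewrite big_cons.
by rewrite RintegralD// ih2 RintegralZl// big_cons.
Qed.

(** A uniform approximation of f by a finite combination of the psi i reduces
    the comparison of the integrals of f under two probabilities to that of
    finitely many moments. *)
Lemma Rintegral_diff_le (R : realType) (disp : measure_display)
    (T : measurableType disp) (G H : probability T R) (I : finType)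
    (k : I -> R) (psi : I -> T -> R) (f : T -> R) (M b e delta : R) :
  measurable_fun [set: T] f -> (forall t, `|f t| <= M) ->
  (forall i, measurable_fun [set: T] (psi i)) ->
  (forall i t, `|psi i t| <= b) ->
  (forall t, `|f t - \sum_i k i * psi i t| <= e) ->
  (forall i, `|\int[G]_(t in [set: T]) psi i t -
               \int[H]_(t in [set: T]) psi i t| <= delta) ->
  `|\int[G]_(t in [set: T]) f t - \int[H]_(t in [set: T]) f t| <=
  2 * e + (\sum_i `|k i|) * delta.
Proof.
move=> mf fM mpsi psib fe GH.
have err (P : probability T R) :
    `|\int[P]_(t in [set: T]) f t -
      \sum_i k i * \int[P]_(t in [set: T]) psi i t| <= e.
  have [|int1 <-] := @Rintegral_lincomb _ _ _ P _ (index_enum I) k psi.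
    by move=> i; exact: bounded_integrable (mpsi i) (psib i).
  rewrite -RintegralB//; last exact: bounded_integrable mf fM.
  apply: normr_Rintegral_le fe; apply: measurable_funB => //.
  by apply: measurable_sum => i; exact: measurable_funM.
have := err H; have := err G.
set g := \int[G]_(t in _) f t; set h := \int[H]_(t in _) f t.
set gs := \sum_i k i * _; set hs := \sum_i k i * _ => eG eH.
have gh : `|gs - hs| <= (\sum_i `|k i|) * delta.
  rewrite -sumrB mulr_suml; apply: (le_trans (ler_norm_sum _ _ _)).
  by apply: ler_sum => i _; rewrite -mulrBr normrM ler_wpM2l.
have -> : g - h = (g - gs) - (h - hs) + (gs - hs) by ring.
apply: (le_trans (ler_normD _ _)); rewrite lerD//.
by apply: (le_trans (ler_normB _ _)); lra.
Qed.

(** * Differentiating a mixture under the integral sign *)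

(** From e^w >= 1 + w and e^(-w) >= 1 - w one gets
    0 <= e^w - 1 - w <= w (e^w - 1), which is then bounded on each side of
    w = 0. *)
Lemma expR_sub1_sub_le (R : realType) (w : R) :
  `|expR w - 1 - w| <= w ^+ 2 * expR `|w|.
Proof.
have h1 := expR_ge1Dx w; have h2 := expR_ge1Dx (- w).
have h3 := expRxMexpNx_1 w; have e0 := expR_gt0 w.
have h4 : expR w - 1 <= w * expR w.
  have : expR w * (1 - w) <= expR w * expR (- w) by rewrite ler_wpM2l ?(ltW e0).
  by rewrite h3; nra.
rewrite ger0_norm; last lra.
have [w0|w0] := leP 0 w.
  by rewrite ger0_norm//; nra.
rewrite ltr0_norm//.
have : 1 <= expR (- w) by rewrite -[leLHS]expR0 ler_expR; lra.
nra.
Qed.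

Lemma gauss_density_shift (R : realType) (d : nat) (l : 'I_d) (h : R)
    (z : 'rV[R]_d) :
  gauss_density (h *: delta_mx 0 l + z) =
  gauss_density z * expR (- (z 0 l * h) - h ^+ 2 / 2).
Proof.
rewrite /gauss_density -mulrA -expRD; congr (_ * expR _).
rewrite !sqr_enorm (bigD1 l)//= [X in _ = - (X / 2) + _](bigD1 l)//=.
rewrite !mxE !eqxx /=.
under eq_bigr => i /negbTE il do rewrite !mxE il andbF mulr0 add0r.
by field.
Qed.

(** The constant is uniform in z: in the direction l the increment is
    controlled by a multiple of h^2 e^(2(|s| + 1)) with s = z_l, and the
    factor e^(-s^2/2) of the density compensates this growth in s. *)
Lemma gauss_density_taylor (R : realType) (d : nat) (l : 'I_d) (h : R)
    (z : 'rV[R]_d) :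
  (1 <= d)%N -> `|h| <= 1 ->
  `|gauss_density (h *: delta_mx 0 l + z) - gauss_density z -
    h * gauss_kernel (Some l) z| <= (4 * expR 4 + 1) * h ^+ 2.
Proof.
move=> d1 h1; rewrite gauss_density_shift /gauss_kernel /=.
set s := z 0 l; set w := - (s * h) - h ^+ 2 / 2.
have -> : gauss_density z * expR w - gauss_density z - h * (- s * gauss_density z)
    = gauss_density z * ((expR w - 1 - w) - h ^+ 2 / 2) by rewrite /w; field.
rewrite normrM.
have gz : `|gauss_density z| <= expR (- (s ^+ 2 / 2)).
  rewrite /gauss_density -/(gauss_const R d) normrM ger0_norm ?gauss_const_ge0//.
  rewrite ger0_norm ?expR_ge0// -[leRHS]mul1r ler_pM ?expR_ge0 ?gauss_const_ge0//.
    by have := gauss_const_le R d1; lra.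
  rewrite ler_expR lerN2 ler_wpM2r// -[_ ^+ 2]real_normK ?num_real//.
  by rewrite lerXn2r ?nnegrE ?enorm_ge0 ?coord_le_enorm.
set x := `|s| + 1.
have hh : h ^+ 2 <= `|h| by rewrite -real_normK ?num_real// expr2 ler_piMl.
have wx : `|w| <= `|h| * x.
  rewrite (le_trans (ler_normB _ _))// normrN normrM.
  by rewrite [`|h ^+ 2 / 2|]ger0_norm ?divr_ge0 ?sqr_ge0// /x; nra.
have x0 : 0 <= x by rewrite /x addr_ge0.
have wx1 : `|w| <= x by rewrite (le_trans wx)// ler_piMl.
have b1 : `|expR w - 1 - w| <= h ^+ 2 * (4 * expR (2 * x)).
  apply: (le_trans (expR_sub1_sub_le _)).
  have -> : 2 * x = x + x by ring.
  have xe : x ^+ 2 <= 4 * expR x.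
    have -> : x = x / 2 + x / 2 by field.
    rewrite expRD; have := expR_ge1Dx (x / 2).
    have := expR_gt0 (x / 2); nra.
  have -> : h ^+ 2 * (4 * expR (x + x)) = h ^+ 2 * (4 * expR x) * expR x.
    by rewrite expRD; ring.
  rewrite ler_pM ?expR_ge0 ?sqr_ge0 ?ler_expR//.
  rewrite -real_normK ?num_real//; apply: (@le_trans _ _ ((`|h| * x) ^+ 2)).
    by rewrite lerXn2r ?nnegrE ?mulr_ge0.
  by rewrite exprMn real_normK ?num_real// ler_wpM2l ?sqr_ge0.
apply: (@le_trans _ _ (expR (- (s ^+ 2 / 2)) *
    (h ^+ 2 * (4 * expR (2 * x)) + h ^+ 2 / 2))).
  rewrite ler_pM// (le_trans (ler_normB _ _))// lerD//.
  by rewrite ger0_norm// divr_ge0 ?sqr_ge0.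
have -> : expR (- (s ^+ 2 / 2)) * (h ^+ 2 * (4 * expR (2 * x)) + h ^+ 2 / 2) =
  (4 * expR (2 * x - s ^+ 2 / 2) + expR (- (s ^+ 2 / 2)) / 2) * h ^+ 2.
  by rewrite expRD; field.
rewrite ler_wpM2r ?sqr_ge0// lerD//.
  rewrite ler_wpM2l// ler_expR /x -[s ^+ 2]real_normK ?num_real//.
  have := sqr_ge0 (`|s| - 2); nra.
by have := @expRN_sqr_le1 R s 2 ltac:(lra); lra.
Qed.

(** Integrating the uniform second-order estimate [gauss_density_taylor]
    against a probability keeps the bound C h^2; dividing by h shows that the
    difference quotients converge. *)
Lemma is_derive_gauss_mixture (R : realType) (d : nat)
    (G : probability (borelRd R d) R) (x : 'rV[R]_d) (l : 'I_d) :
  (1 <= d)%N ->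
  is_derive x (delta_mx 0 l) (gauss_mixture G)
    (\int[G]_(t in [set: borelRd R d]) gauss_kernel (Some l) (x - (t : 'rV[R]_d))).
Proof.
move=> d1; set D := \int[G]_(t in _) _.
pose C : R := 4 * expR 4 + 1.
have C0 : 0 < C by rewrite /C; have := expR_gt0 (4 : R); lra.
have key h : `|h| <= 1 ->
    `|gauss_mixture G (h *: delta_mx 0 l + x) - gauss_mixture G x - h * D|
      <= C * h ^+ 2.
  move=> h1; rewrite /gauss_mixture /D.
  have mk o (y : 'rV[R]_d) := measurable_gauss_kernel o y.
  have ik o (y : 'rV[R]_d) := bounded_integrable G (mk o y)
    (fun t => normr_gauss_kernel_le o (y - t)).
  have mg y : measurable_fun [set: borelRd R d]
      (fun t : borelRd R d => gauss_density (y - (t : 'rV[R]_d))).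
    have := mk None y; rewrite /gauss_kernel /=.
    by under eq_fun do rewrite mul1r.
  have ig y : G.-integrable [set: borelRd R d]
      (EFin \o (fun t : borelRd R d => gauss_density (y - (t : 'rV[R]_d)))).
    have := ik None y; rewrite /gauss_kernel /comp /=.
    by under eq_fun do rewrite mul1r.
  rewrite -RintegralZl// -RintegralB// -RintegralB//; last 2 first.
  - exact: (integrableB measurableT (ig _) (ig _)).
  - exact: (integrableZl measurableT h (ik (Some l) x)).
  apply: normr_Rintegral_le.
    apply: measurable_funB; first by apply: measurable_funB; exact: mg.
    by apply: measurable_funM => //; exact: mk.
  by move=> t; have := gauss_density_taylor l (x - t) d1 h1; rewrite addrA.
have cvgD : h^-1 *: ((gauss_mixture G \o shift x) (h *: delta_mx 0 l) -
    gauss_mixture G x) @[h --> 0^'] --> D.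
  apply/cvgrPdist_le => e e0.
  near=> h.
  have h0 : h != 0 by near: h; exact: nbhs_dnbhs_neq.
  have hs : `|h| <= Num.min 1 (e / C).
    near: h; apply: dnbhs0_le; first by rewrite lt_min ltr01 divr_gt0.
  have h1 : `|h| <= 1 by rewrite (le_trans hs)// ge_min lexx.
  have h2 : `|h| <= e / C by rewrite (le_trans hs)// ge_min lexx orbT.
  rewrite distrC /= /shift /=.
  have -> : h^-1 *: (gauss_mixture G (h *: delta_mx 0 l + x) - gauss_mixture G x)
     - D = h^-1 * (gauss_mixture G (h *: delta_mx 0 l + x) - gauss_mixture G x - h * D).
    by rewrite [in RHS]mulrBr mulKf.
  rewrite normrM normfV ler_pdivrMl ?normr_gt0//.
  apply: (le_trans (key h h1)).
  rewrite -real_normK ?num_real// expr2 mulrCA ler_wpM2l//.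
  by rewrite mulrC -ler_pdivlMr.
split.
  by apply/cvg_ex; exists D.
exact: cvg_lim cvgD.
Unshelve. all: by end_near. Qed.

Lemma gradient_gauss_mixtureB (R : realType) (d : nat)
    (G H : probability (borelRd R d) R) (x : 'rV[R]_d) (l : 'I_d) :
  (1 <= d)%N ->
  gradient (gauss_mixture G \- gauss_mixture H) x 0 l =
  \int[G]_(t in [set: borelRd R d]) gauss_kernel (Some l) (x - (t : 'rV[R]_d)) -
  \int[H]_(t in [set: borelRd R d]) gauss_kernel (Some l) (x - (t : 'rV[R]_d)).
Proof.
move=> d1; rewrite mxE.
have dG := is_derive_gauss_mixture G x l d1.
have dH := is_derive_gauss_mixture H x l d1.
rewrite deriveB; [|exact: ex_derive|exact: ex_derive].
by rewrite !derive_val.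
Qed.

Lemma gauss_mixtureE (R : realType) (d : nat)
    (G : probability (borelRd R d) R) (x : 'rV[R]_d) :
  gauss_mixture G x =
  \int[G]_(t in [set: borelRd R d]) gauss_kernel None (x - (t : 'rV[R]_d)).
Proof. by apply: eq_Rintegral => t _; rewrite /gauss_kernel /= mul1r. Qed.

(** * Coverings from finite codes *)

Lemma bin_close (R : realType) (delta y z : R) :
  0 < delta -> 0 <= y -> 0 <= z ->
  Num.truncn (y / delta) = Num.truncn (z / delta) -> `|y - z| <= delta.
Proof.
move=> d0 y0 z0 yz.
have /andP[y1 y2] := truncn_itv (divr_ge0 y0 (ltW d0)).
have /andP[z1 z2] := truncn_itv (divr_ge0 z0 (ltW d0)).
rewrite -yz in z1 z2; move: y1 y2 z1 z2; rewrite -natr1.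
rewrite !ler_pdivlMr// !ltr_pdivrMr// mulrDl mul1r.
set r := _ * delta => *; rewrite ler_norml; apply/andP; split; lra.
Qed.

(** Pick one index for each code that is attained: its image is a center, and
    lies within eta of every image with the same code. *)
Lemma covering_number_le_code (R : realType) (T I : Type) (F : I -> T)
    (K : finType) (code : I -> K) (rho : T -> T -> \bar R) (eta : R) (i0 : I) :
  (forall i j, code i = code j -> (rho (F i) (F j) <= eta%:E)%E) ->
  (lne (covering_number eta [set f | exists i, f = F i] rho) <=
    (ln (#|K|%:R))%:E)%E.
Proof.
move=> codeP.
have K0 : (0 < #|K|)%N by apply/card_gt0P; exists (code i0).
have cov_ge0 : (0 <= covering_number eta [set f | exists i, f = F i] rho)%E.
  by apply: le_ereal_inf_tmp => _ [n _ <-]; rewrite lee_fin.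
rewrite -lne_EFin ?ltr0n// lee_lne ?in_itv/= ?leey ?andbT ?lee_fin//.
apply: ereal_inf_lbound; exists #|K| => //; split => //.
pose c (k : 'I_#|K|) : I := if pselect (exists i, code i = enum_val k) is left e
  then projT1 (cid e) else i0.
exists (F \o c); split; first by move=> k; exists (c k).
apply: ge_ereal_sup => _ [_ [i ->] <-].
apply: (@le_trans _ _ (rho (F i) (F (c (enum_rank (code i)))))).
  by apply: ereal_inf_lbound; exists (enum_rank (code i)).
apply: codeP; rewrite /c enum_rankK; case: pselect => [e|[]]; last by exists i.
by case: cid.
Qed.

Lemma supnorm_le (R : realType) (d : nat) (S : set 'rV[R]_d)
    (f : 'rV[R]_d -> R) (e : R) :
  0 <= e -> (forall x, S x -> `|f x| <= e) -> (supnorm S f <= e%:E)%E.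
Proof.
move=> e0 fe; apply: ge_ereal_sup => _ [->|[x Sx <-]]; first by rewrite lee_fin.
by rewrite lee_fin fe.
Qed.

Lemma grad_supnorm_le (R : realType) (d : nat) (S : set 'rV[R]_d)
    (f : 'rV[R]_d -> R) (e : R) :
  0 <= e -> (forall x l, S x -> d%:R * `|gradient f x 0 l| <= e) ->
  (grad_supnorm S f <= e%:E)%E.
Proof.
move=> e0 fe; apply: ge_ereal_sup => _ [->|[x Sx <-]]; first by rewrite lee_fin.
rewrite lee_fin; apply: (le_trans (enorm_le_sum _)).
have [d0|d0] := posnP d.
  by rewrite big1 // => -[i id]; exfalso; rewrite d0 in id.
apply: (@le_trans _ _ (\sum_(i < d) e / d%:R)).
  apply: ler_sum => l _; rewrite ler_pdivlMr ?ltr0n// mulrC; exact: fe.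
by rewrite sumr_const card_ord -[leLHS]mulr_natr divfK// pnatr_eq0 -lt0n.
Qed.

Lemma sub_enlargement (R : realType) (d : nat) (S : set 'rV[R]_d) (a : R) :
  0 <= a -> S `<=` enlargement S a.
Proof.
move=> a0 x Sx; rewrite /enlargement /=.
apply: (@le_trans _ _ (enorm (x - x))%:E).
  by apply: ereal_inf_lbound; exists x.
rewrite lee_fin subrr /enorm big1 ?sqrtr0//.
by move=> i _; rewrite mxE expr0n.
Qed.

(** The two hypotheses on e bound the approximation error of the kernel inside
    and outside the ball of radius b about c. *)
Lemma mixture_integral_close (R : realType) (d K : nat)
    (G H : probability (borelRd R d) R) (c x : 'rV[R]_d) (a b e delta : R) :
  (1 <= d)%N -> 1 <= a -> 1 <= b -> 0 <= delta -> enorm (x - c) <= a ->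
  (a + b) * (d%:R * (expR (a * b) ^+ d * expR (4 * (a * b) - K%:R))) <= e ->
  gauss_const R d * expR (- ((b ^+ 2 / 2 - a ^+ 2) / 4)) <= e ->
  (forall p : option 'I_d * {ffun 'I_d -> 'I_K},
    `|\int[G]_(t in [set: borelRd R d]) moment_fun c b p (t : 'rV[R]_d) -
      \int[H]_(t in [set: borelRd R d]) moment_fun c b p (t : 'rV[R]_d)|
    <= delta) ->
  forall o : option 'I_d,
  `|\int[G]_(t in [set: borelRd R d]) gauss_kernel o (x - (t : 'rV[R]_d)) -
    \int[H]_(t in [set: borelRd R d]) gauss_kernel o (x - (t : 'rV[R]_d))|
  <= 2 * e + (a + 1) * expR (a * b) ^+ d * delta.
Proof.
move=> d1 a1 b1 delta0 xa near_e far_e GH o.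
have := @Rintegral_diff_le R _ (borelRd R d) G H
  (option 'I_d * {ffun 'I_d -> 'I_K})%type
  (fun p => kernel_coef o b p (x - c))
  (fun p (t : borelRd R d) => moment_fun c b p (t : 'rV[R]_d))
  (fun t : borelRd R d => gauss_kernel o (x - (t : 'rV[R]_d)))
  (gauss_const R d) b e delta.
move=> /(_ (measurable_gauss_kernel o x)
  (fun t => normr_gauss_kernel_le o (x - t))
  (fun p => measurable_moment_fun c b p)
  (fun p t => normr_moment_fun c p t b1)) h.
apply: (le_trans (h _ GH)).
  move=> t; have [tb|tb] := leP (enorm ((t : 'rV[R]_d) - c)) b.
    exact: le_trans (kernel_approx _ _ d1 a1 b1 xa tb) near_e.
  by apply: le_trans (kernel_approx_far _ _ xa _ tb) far_e; lra.
rewrite lerD2l ler_wpM2r//; exact: sum_kernel_coef.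
Qed.

(** The bin containing each moment; adding b makes the moments nonnegative, so
    that truncation to a natural number is rounding down. *)
Definition moment_code (R : realType) (d K N n : nat) (c : 'I_N -> 'rV[R]_d)
    (b delta : R) (G : probability (borelRd R d) R) :
    {ffun 'I_N * (option 'I_d * {ffun 'I_d -> 'I_K}) -> 'I_n.+1} :=
  [ffun q => inord (Num.truncn
    ((\int[G]_(t in [set: borelRd R d]) moment_fun (c q.1) b q.2 (t : 'rV[R]_d)
      + b) / delta))].

Lemma moment_code_close (R : realType) (d K N n : nat) (c : 'I_N -> 'rV[R]_d)
    (b delta : R) (G H : probability (borelRd R d) R) :
  1 <= b -> 0 < delta -> 2 * b / delta < n.+1%:R ->
  moment_code K n c b delta G = moment_code K n c b delta H ->
  forall i (p : option 'I_d * {ffun 'I_d -> 'I_K}),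
    `|\int[G]_(t in [set: borelRd R d]) moment_fun (c i) b p (t : 'rV[R]_d) -
      \int[H]_(t in [set: borelRd R d]) moment_fun (c i) b p (t : 'rV[R]_d)|
    <= delta.
Proof.
move=> b1 d0 nb /ffunP GH i p; have := GH (i, p); rewrite !ffunE /=.
set g := \int[G]_(t in _) _; set h := \int[H]_(t in _) _.
have bnd (P : probability (borelRd R d) R) :
    `|\int[P]_(t in [set: borelRd R d]) moment_fun (c i) b p (t : 'rV[R]_d)| <= b.
  apply: normr_Rintegral_le; first exact: measurable_moment_fun.
  by move=> t; exact: normr_moment_fun.
have := bnd G; have := bnd H; rewrite -/g -/h !ler_norml => /andP[h1 h2] /andP[g1 g2].
have small y : 0 <= y + b -> y <= b -> (Num.truncn ((y + b) / delta) < n.+1)%N.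
  move=> y0 yb; rewrite truncn_lt_nat ?divr_ge0 ?(ltW d0)//.
  by apply: le_lt_trans nb; rewrite ler_pdivrMr// divfK ?gt_eqF//; lra.
move=> /(congr1 val) /=; rewrite !inordK ?small//; try lra.
move=> gh.
have -> : g - h = (g + b) - (h + b) by ring.
by rewrite -ler_norml; apply: (bin_close d0 _ _ gh); lra.
Qed.

Lemma card_moment_code (d K N n : nat) :
  #|{ffun 'I_N * (option 'I_d * {ffun 'I_d -> 'I_K}) -> 'I_n.+1}| =
  (n.+1 ^ (N * (d.+1 * K ^ d)))%N.
Proof.
by rewrite card_ffun !card_prod card_option card_ffun !card_ord.
Qed.

(** * Choice of the parameters *)

(** All the factors a + b, d, e^(abd) are at most e^(O(T)) with
    T = ab = 4 d a^2, or constants depending on d; e^(-K) beats them and still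
    leaves e^(-L). *)
Lemma near_error_le (R : realType) (d K : nat) (a L : R) :
  (1 <= d)%N -> 1 <= a ->
  (d%:R + 5) * (4 * d%:R * a ^+ 2) + L + 8 * d%:R ^+ 2 <= K%:R ->
  forall b, b = 4 * d%:R * a ->
  (a + b) * (d%:R * (expR (a * b) ^+ d * expR (4 * (a * b) - K%:R))) <=
  expR (- L) / (4 * d%:R).
Proof.
move=> d1 a1 KL b bE; set D : R := d%:R in KL bE *.
have D1 : 1 <= D by rewrite /D ler1n.
have -> : a * b = 4 * D * a ^+ 2 by rewrite bE; ring.
set T := 4 * D * a ^+ 2 in KL *.
have aa : a <= a ^+ 2 by nra.
have Daa : D * a <= D * a ^+ 2 by rewrite ler_wpM2l//; lra.
have aD : a <= D * a by nra.
have abT : a + b <= 2 * T by rewrite /T bE; lra.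
have T0 : 0 <= T by rewrite /T; lra.
have Te : T <= expR T by have := expR_ge1Dx T; lra.
rewrite -expRM_natl -/D -expRD ler_pdivlMr; last lra.
have e8 : 8 * D ^+ 2 <= expR (8 * D ^+ 2) by have := expR_ge1Dx (8 * D ^+ 2); lra.
have eK : expR (T + (D * T + (4 * T - K%:R))) * expR (8 * D ^+ 2) <= expR (- L).
  by rewrite -expRD ler_expR; lra.
apply: le_trans eK.
rewrite (expRD T); set E := expR (D * T + _).
have E0 : 0 < E by exact: expR_gt0.
have -> : (a + b) * (D * E) * (4 * D) = (a + b) * E * (4 * D ^+ 2) by ring.
have -> : expR T * E * expR (8 * D ^+ 2) =
  2 * expR T * E * (expR (8 * D ^+ 2) / 2) by field.
rewrite ler_pM//.
- by rewrite mulr_ge0 ?(ltW E0)//; rewrite bE; lra.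
- by rewrite mulr_ge0// sqr_ge0.
- by rewrite ler_pM2r//; lra.
- by lra.
Qed.

(** With b = 4 d a the squared distance to x is at least (8 d^2 - 1) a^2, so
    the decay e^(-(2 d^2 - 1/4) a^2) of the kernel beats the given
    e^(-a^2/2) by a further factor e^(-d) <= 1/d.  That factor is used to
    bound the Euclidean norm of a gradient by the sum of its coordinates. *)
Lemma far_error_le (R : realType) (d : nat) (a eta : R) :
  (1 <= d)%N -> 1 <= a -> gauss_const R d * expR (- (a ^+ 2 / 2)) <= eta / 4 ->
  forall b, b = 4 * d%:R * a ->
  gauss_const R d * expR (- ((b ^+ 2 / 2 - a ^+ 2) / 4)) <= eta / (4 * d%:R).
Proof.
move=> d1 a1 ca b bE; set D : R := d%:R in bE *.
have D1 : 1 <= D by rewrite /D ler1n.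
have D0 : 0 < D by lra.
rewrite invfM mulrA ler_pdivlMr//; apply: le_trans ca; rewrite -mulrA.
rewrite ler_wpM2l ?gauss_const_ge0//.
apply: (@le_trans _ _ (expR (- (a ^+ 2 / 2)) * expR (- D) * D)).
  rewrite -expRD ler_wpM2r ?(ltW D0)// ler_expR bE.
  have : 1 <= a ^+ 2 by rewrite expr_ge1//; lra.
  have : 1 <= D ^+ 2 by rewrite expr_ge1//; lra.
  have : D <= D ^+ 2 by nra.
  rewrite !exprMn; nra.
rewrite -mulrA ler_piMr ?expR_ge0// expRN mulrC ler_pdivrMr ?expR_gt0// mul1r.
by have := expR_ge1Dx D; lra.
Qed.

(** The error budget for each coordinate is eta / d: the kernel approximation
    takes 2 eta / (4 d), and delta is the width for which the moment errors,
    multiplied by the bound of [sum_kernel_coef], take the other half. *)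
Lemma moment_code_pseudonorms (R : realType) (d K N n : nat)
    (S : set 'rV[R]_d) (c : 'I_N -> 'rV[R]_d) (a eta : R) :
  (1 <= d)%N -> 1 <= a -> 0 < eta ->
  S `<=` \bigcup_(i in [set: 'I_N]) closed_eball (c i) a ->
  gauss_const R d * expR (- (a ^+ 2 / 2)) <= eta / 4 ->
  (d%:R + 5) * (4 * d%:R * a ^+ 2) - ln eta + 8 * d%:R ^+ 2 <= K%:R ->
  let b := 4 * d%:R * a in
  let delta := eta / (2 * d%:R * ((a + 1) * expR (a * b) ^+ d)) in
  2 * b / delta < n.+1%:R ->
  forall G H : probability (borelRd R d) R,
  moment_code K n c b delta G = moment_code K n c b delta H ->
  (supnorm S (gauss_mixture G \- gauss_mixture H)%R <= eta%:E)%E /\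
  (grad_supnorm S (gauss_mixture G \- gauss_mixture H)%R <= eta%:E)%E.
Proof.
move=> d1 a1 eta0 Sc ca KL b delta nb G H GH.
have D1 : 1 <= d%:R :> R by rewrite ler1n.
have b1 : 1 <= b by rewrite /b; nra.
have w0 : 0 < (a + 1) * expR (a * b) ^+ d.
  by rewrite mulr_gt0 ?exprn_gt0 ?expR_gt0//; lra.
have delta0 : 0 < delta by rewrite divr_gt0// mulr_gt0//; lra.
have close x o : S x ->
    d%:R * `|\int[G]_(t in [set: borelRd R d]) gauss_kernel o (x - (t : 'rV[R]_d)) -
    \int[H]_(t in [set: borelRd R d]) gauss_kernel o (x - (t : 'rV[R]_d))| <= eta.
  move=> /Sc [i _ xi].
  have := @mixture_integral_close R d K G H (c i) x a b (eta / (4 * d%:R)) delta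
    d1 a1 b1 (ltW delta0) xi.
  rewrite -{1}[eta]lnK// -{1}[ln eta]opprK.
  move=> /(_ (near_error_le d1 a1 KL erefl) (far_error_le d1 a1 ca erefl)
    (moment_code_close b1 delta0 nb GH i) o) h.
  rewrite mulrC -ler_pdivlMr; last lra.
  apply: (le_trans h); rewrite /delta le_eqVlt; apply/orP; left; apply/eqP.
  field; apply/and3P; split; rewrite ?expf_neq0 ?gt_eqF ?expR_gt0//; lra.
split; [apply: supnorm_le; first exact: ltW|
        apply: grad_supnorm_le; first exact: ltW].
- move=> x Sx; have := close x None Sx; rewrite -!gauss_mixtureE /=.
  by have := normr_ge0 (gauss_mixture G x - gauss_mixture H x); nra.
- by move=> x l Sx; rewrite gradient_gauss_mixtureB//; exact: close.
Qed.

(** Product of bounds for three quantities: the logarithm of the number of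
    bins divided by L = - ln eta, the number d + 1 of kernel weights, and
    (K / L)^d. *)
Definition entropy_const (R : realType) (d : nat) : R :=
  (64 * d%:R + 40 * d%:R * (d%:R + 1) + 1) * (d%:R + 1) *
  (40 * d%:R * (d%:R + 5) + 32 * d%:R ^+ 2 + 5) ^+ d.

Lemma bins_le (R : realType) (d : nat) (a L : R) :
  (1 <= d)%N -> 1 <= a -> 0 <= L ->
  forall b, b = 4 * d%:R * a ->
  2 * b / (expR (- L) / (2 * d%:R * ((a + 1) * expR (a * b) ^+ d))) + 1 <=
  expR (16 * d%:R + (d%:R + 1) * (4 * d%:R * a ^+ 2) + L).
Proof.
move=> d1 a1 L0 b bE; set D : R := d%:R in bE *.
have D1 : 1 <= D by rewrite /D ler1n.
have -> : a * b = 4 * D * a ^+ 2 by rewrite bE; ring.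
set T := 4 * D * a ^+ 2.
have aa : a <= a ^+ 2 by nra.
have Daa : D * a <= D * a ^+ 2 by rewrite ler_wpM2l//; lra.
have aD : a <= D * a by nra.
have T1 : 1 <= T by rewrite /T; lra.
have Te : T <= expR T by have := expR_ge1Dx T; lra.
rewrite -expRM_natl -/D invfM invrK expRN invrK.
have -> : 2 * b * (expR L * (2 * D * ((a + 1) * expR (D * T)))) =
  (4 * D * (b * (a + 1))) * (expR (D * T) * expR L) by ring.
set E := expR (D * T) * expR L.
have E1 : 1 <= E.
  by rewrite /E -expRD -[leLHS]expR0 ler_expR addr_ge0// mulr_ge0//; lra.
have ba : b * (a + 1) <= 2 * T by rewrite /T bE; lra.
have -> : expR (16 * D + (D + 1) * T + L) = expR (16 * D) * expR T * E.
  by rewrite /E -!expRD; congr expR; ring.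
have e16 : 16 * D <= expR (16 * D) by have := expR_ge1Dx (16 * D); lra.
apply: (@le_trans _ _ (16 * D * expR T * E)); last first.
  by rewrite ler_wpM2r ?(le_trans _ E1)// ler_wpM2r ?expR_ge0.
apply: (@le_trans _ _ (16 * D * T * E)); last first.
  by rewrite ler_wpM2r ?(le_trans _ E1)// ler_wpM2l//; lra.
have : 4 * D * (b * (a + 1)) <= 4 * D * (2 * T) by rewrite ler_wpM2l//; lra.
have : 1 <= D * T by nra.
nra.
Qed.

(** The lower bound on L absorbs the additive constants, which depend on d
    alone, into multiples of L. *)
Lemma entropy_le (R : realType) (d N : nat) (S : set 'rV[R]_d)
    (c : 'I_N -> 'rV[R]_d) (a eta : R) :
  (1 <= d)%N -> 1 <= a -> 0 < eta ->
  let L := - ln eta in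
  4^-1 <= L -> a ^+ 2 <= 10 * L ->
  S `<=` \bigcup_(i in [set: 'I_N]) closed_eball (c i) a ->
  gauss_const R d * expR (- (a ^+ 2 / 2)) <= eta / 4 ->
  (lne (covering_number eta (mixtures R d)
          (fun f g => supnorm S (f \- g)%R)) <=
    (entropy_const R d * N%:R * L ^+ d.+1)%:E)%E /\
  (lne (covering_number eta (mixtures R d)
          (fun f g => grad_supnorm S (f \- g)%R)) <=
    (entropy_const R d * N%:R * L ^+ d.+1)%:E)%E.
Proof.
move=> d1 a1 eta0 L L4 aL Sc ca.
have D1 : 1 <= d%:R :> R by rewrite ler1n.
set D : R := d%:R in D1.
pose x := (D + 5) * (4 * D * a ^+ 2) - ln eta + 8 * D ^+ 2.
pose b := 4 * D * a.
pose delta := eta / (2 * D * ((a + 1) * expR (a * b) ^+ d)).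
pose y := 2 * b / delta.
have a0 : 0 < a by lra.
have x0 : 0 <= x.
  by rewrite /x -/L; do ?apply: addr_ge0; rewrite ?mulr_ge0 ?sqr_ge0//; lra.
have y0 : 0 <= y.
  rewrite /y /delta /b !(divr_ge0, mulr_ge0, exprn_ge0, expR_ge0)//; lra.
(* K is the least integer above the threshold x of near_error_le, and n + 1
   bins of width delta cover an interval of length 2 b. *)
pose K := (Num.truncn x).+1; pose n := Num.truncn y.
have /andP[xlo xhi] := truncn_itv x0; have /andP[ylo yhi] := truncn_itv y0.
have codeP := @moment_code_pseudonorms R d K N n S c a eta d1 a1 eta0 Sc ca
  (ltW xhi) yhi.
have KL : K%:R <= (40 * D * (D + 5) + 32 * D ^+ 2 + 5) * L.
  rewrite /K -natr1; apply: (@le_trans _ _ (x + 1)); first by rewrite lerD2r.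
  have h1 : (D + 5) * (4 * D * a ^+ 2) <= (D + 5) * (4 * D * (10 * L)).
    by rewrite ler_wpM2l ?ler_wpM2l//; lra.
  have h2 : 8 * D ^+ 2 <= 8 * D ^+ 2 * (4 * L).
    by rewrite ler_peMr ?mulr_ge0 ?sqr_ge0//; lra.
  by rewrite /x -/L; lra.
have nL : ln n.+1%:R <= (64 * D + 40 * D * (D + 1) + 1) * L.
  apply: (@le_trans _ _ (16 * D + (D + 1) * (4 * D * a ^+ 2) + L)); last first.
    have h1 : (D + 1) * (4 * D * a ^+ 2) <= (D + 1) * (4 * D * (10 * L)).
      by rewrite ler_wpM2l ?ler_wpM2l//; lra.
    have h2 : 16 * D <= 16 * D * (4 * L) by rewrite ler_peMr; lra.
    lra.
  rewrite -[leRHS]expRK ler_ln ?posrE ?ltr0n ?expR_gt0//.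
  rewrite -natr1; apply: (@le_trans _ _ (y + 1)); first by rewrite lerD2r.
  have := @bins_le R d a L d1 a1 _ _ erefl; rewrite -/D -/b.
  have -> : expR (- L) = eta by rewrite /L opprK lnK.
  by apply; lra.
have card_le : ln #|{ffun 'I_N * (option 'I_d * {ffun 'I_d -> 'I_K}) -> 'I_n.+1}|%:R
    <= entropy_const R d * N%:R * L ^+ d.+1.
  rewrite card_moment_code natrX lnXn ?ltr0n// -[_ *+ (N * _)]mulr_natr.
  rewrite !natrM natrX -[d.+1%:R]natr1 -/D.
  rewrite /entropy_const -/D.
  set C1 := 40 * D * (D + 5) + 32 * D ^+ 2 + 5 in KL *.
  set C2 := 64 * D + 40 * D * (D + 1) + 1 in nL *.
  have -> : C2 * (D + 1) * C1 ^+ d * N%:R * L ^+ d.+1 =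
    (C2 * L) * (N%:R * ((D + 1) * (C1 * L) ^+ d)) by rewrite exprMn exprS; ring.
  have lnn : 0 <= ln n.+1%:R :> R by rewrite ln_ge0// ler1n.
  have D10 : 0 <= D + 1 by lra.
  apply: ler_pM => //; first by rewrite !mulr_ge0 ?exprn_ge0.
  rewrite ler_wpM2l// ler_wpM2l// lerXn2r ?nnegrE//.
  exact: le_trans KL.
have G0 : probability (borelRd R d) R.
  exact: (@dirac _ (borelRd R d) (0 : 'rV[R]_d) R : probability _ _).
have cover rho : (forall G H, moment_code K n c b delta G =
      moment_code K n c b delta H ->
      (rho (gauss_mixture G) (gauss_mixture H) <= eta%:E)%E) ->
    (lne (covering_number eta (mixtures R d) rho) <=
      (entropy_const R d * N%:R * L ^+ d.+1)%:E)%E.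
  move=> close; apply: (@le_trans _ _ _ _ _ (covering_number_le_code G0 close)).
  by rewrite lee_fin; exact: card_le.
by split; apply: cover => G H /codeP [].
Qed.

Lemma sqrt_expR1 (R : realType) : Num.sqrt (expR 1) = expR 2^-1 :> R.
Proof.
have -> : expR 1 = expR 2^-1 ^+ 2 :> R by rewrite -expRM_natr mulVf.
by rewrite sqrtr_sqr ger0_norm ?expR_ge0.
Qed.

(** The radius is defined so that e^(-a^2/2) is, up to the constants, eta
    itself: the density at distance a is at most eta / 4. *)
Lemma radius_facts (R : realType) (d : nat) (eta : R) :
  (1 <= d)%N -> 0 < eta ->
  eta <= 2 * Num.sqrt (2 * pi) / ((2 * pi) `^ (d%:R / 2) * Num.sqrt (expR 1)) ->
  let a := Num.sqrt (2 * ln (2 * Num.sqrt (2 * pi)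
                             / ((2 * pi) `^ (d%:R / 2) * eta))) in
  [/\ 1 <= a, a ^+ 2 <= 2 * (1 - ln eta) &
      gauss_const R d * expR (- (a ^+ 2 / 2)) <= eta / 4].
Proof.
move=> d1 eta0 eta_le a.
have p4 : 4 <= 2 * pi :> R by have := pi_ge2 R; lra.
have p0 : 0 < 2 * pi :> R by lra.
set s := Num.sqrt (2 * pi) in eta_le @a *.
set P := (2 * pi) `^ (d%:R / 2) in eta_le @a *.
have s2 : 2 <= s := sqrt_2pi_ge2 R.
have Ps : s <= P.
  rewrite /s -powR12_sqrt ?(ltW p0)// /P ler_powR//; first lra.
  by rewrite ler_pdivlMr// mulVf// ler1n.
have P0 : 0 < P by lra.
have e0 : 0 < expR 2^-1 :> R by exact: expR_gt0.
rewrite sqrt_expR1 in eta_le.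
set k := 2 * s / (P * eta) in @a *.
have k0 : 0 < k by rewrite /k divr_gt0 ?mulr_gt0//; lra.
have lnk : 2^-1 <= ln k.
  rewrite -[leLHS]expRK ler_ln ?posrE// /k ler_pdivlMr ?mulr_gt0//.
  by move: eta_le; rewrite ler_pdivlMr ?mulr_gt0//; nra.
have a2 : a ^+ 2 = 2 * ln k by rewrite /a sqr_sqrtr//; lra.
split.
- by rewrite -(@ler_pXn2r _ 2)// ?nnegrE ?sqrtr_ge0// a2 expr1n; lra.
- rewrite a2 ler_wpM2l//.
  have : ln k <= ln (2 / eta).
    rewrite ler_ln ?posrE ?(divr_gt0 _ eta0)// /k ler_pdivrMr ?mulr_gt0//.
    have -> : 2 / eta * (P * eta) = 2 * P by field; rewrite gt_eqF.
    lra.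
  rewrite (@ln_div _ 2 eta) ?posrE//.
  have := @le_ln1Dx R 1; have -> : 1 + 1 = 2 :> R by lra.
  by move=> /(_ ltac:(lra)); lra.
- have -> : - (a ^+ 2 / 2) = - ln k by rewrite a2; field.
  rewrite expRN lnK ?posrE// /gauss_const powRN -/P /k invf_div.
  have -> : P^-1 * (P * eta / (2 * s)) = eta / (2 * s).
    by field; rewrite !gt_eqF//; lra.
  by rewrite ler_pM2l// lef_pV2 ?posrE//; lra.
Qed.

(** * Large eta, and the entropy bound *)

(** In dimension one, mixtures take values in [0, 1/2] and their derivatives
    in [-3/8, 3/8], so any single mixture is a 3/4-covering. *)
Lemma entropy_dim1_le0 (R : realType) (S : set 'rV[R]_1) (eta : R) :
  3 / 4 <= eta ->
  (lne (covering_number eta (mixtures R 1)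
          (fun f g => supnorm S (f \- g)%R)) <= 0)%E /\
  (lne (covering_number eta (mixtures R 1)
          (fun f g => grad_supnorm S (f \- g)%R)) <= 0)%E.
Proof.
move=> eta_ge.
have G0 : probability (borelRd R 1) R.
  exact: (@dirac _ (borelRd R 1) (0 : 'rV[R]_1) R : probability _ _).
have c1 := @gauss_const_le R 1 isT; have c0 := gauss_const_gt0 R 1.
have cover rho : (forall G H : probability (borelRd R 1) R,
      (rho (gauss_mixture G) (gauss_mixture H) <= eta%:E)%E) ->
    (lne (covering_number eta (mixtures R 1) rho) <= 0)%E.
  move=> close.
  have := @covering_number_le_code R _ _ (@gauss_mixture R 1) unit (fun=> tt)
    rho eta G0 (fun G H _ => close G H).
  by rewrite card_unit ln1.
have eta0 : 0 <= eta by lra.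
split; apply: cover => G H.
- apply: supnorm_le => // x _ /=.
  have bnd (P : probability (borelRd R 1) R) : 0 <= gauss_mixture P x <= 2^-1.
    apply/andP; split.
      apply: Rintegral_ge0 => t _.
      by rewrite mulr_ge0 ?expR_ge0//; exact: gauss_const_ge0.
    rewrite gauss_mixtureE; apply: le_trans c1; apply: (le_trans (ler_norm _)).
    apply: normr_Rintegral_le; first exact: measurable_gauss_kernel.
    by move=> t; exact: normr_gauss_kernel_le.
  have /andP[? ?] := bnd G; have /andP[? ?] := bnd H.
  by rewrite ler_norml; apply/andP; split; lra.
- apply: grad_supnorm_le => // x l _.
  rewrite mul1r gradient_gauss_mixtureB//.
  have bnd (P : probability (borelRd R 1) R) :
      `|\int[P]_(t in [set: borelRd R 1])
         gauss_kernel (Some l) (x - (t : 'rV[R]_1))| <= 3 / 8.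
    apply: normr_Rintegral_le; first exact: measurable_gauss_kernel.
    by move=> t; apply: (le_trans (normr_gauss_kernel_Some _ _)); lra.
  have := bnd G; have := bnd H => bH bG.
  by apply: (le_trans (ler_normB _ _)); lra.
Qed.

Lemma eta_lt_dim_ge2 (R : realType) (d : nat) (eta : R) :
  (2 <= d)%N ->
  eta <= 2 * Num.sqrt (2 * pi) / ((2 * pi) `^ (d%:R / 2) * Num.sqrt (expR 1)) ->
  eta < 3 / 4.
Proof.
move=> d2 /le_lt_trans; apply.
have p4 : 4 <= 2 * pi :> R by have := pi_ge2 R; lra.
have p0 : 0 < 2 * pi :> R by lra.
set s := Num.sqrt (2 * pi).
have s2 : 2 <= s := sqrt_2pi_ge2 R.
have ss : s * s = 2 * pi by rewrite -expr2 sqr_sqrtr// ltW.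
set P := (2 * pi) `^ (d%:R / 2).
have Ps : s * s <= P.
  rewrite ss -[leLHS]powRr1 ?(ltW p0)// /P ler_powR//; first lra.
  by rewrite ler_pdivlMr// mul1r ler_nat.
have e1 : 3 / 2 <= expR 2^-1 :> R by have := expR_ge1Dx (2^-1 : R); lra.
rewrite sqrt_expR1 ltr_pdivrMr; last by rewrite mulr_gt0 ?expR_gt0//; nra.
have : s * s * (3 / 2) <= P * expR 2^-1 by rewrite ler_pM//; nra.
nra.
Qed.

Theorem theorem4p1 (R : realType) (d : nat) (d_ge1 : (1 <= d)%N) :
  exists C : R, 0 < C /\
    forall (S : set 'rV[R]_d) (eta : R),
      compact S ->
      0 < eta ->
      eta <= 2 * Num.sqrt (2 * pi)
             / ((2 * pi) `^ (d%:R / 2) * Num.sqrt (expR 1)) ->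
      let a := Num.sqrt (2 * ln (2 * Num.sqrt (2 * pi)
                                 / ((2 * pi) `^ (d%:R / 2) * eta))) in
      (lne (covering_number eta (mixtures R d)
              (fun f g => supnorm S (f \- g)%R))
       <= C%:E * euclidean_covering_number a (enlargement S a)
          * (`|ln eta| ^+ d.+1)%:E)%E
      /\
      (lne (covering_number eta (mixtures R d)
              (fun f g => grad_supnorm S (f \- g)%R))
       <= C%:E * euclidean_covering_number a (enlargement S a)
          * (`|ln eta| ^+ d.+1)%:E)%E.
Proof.
have C0 : 0 < entropy_const R d.
  have D1 : 1 <= d%:R :> R by rewrite ler1n.
  have D2 : 0 <= d%:R * d%:R :> R by rewrite mulr_ge0.
  by rewrite /entropy_const !mulr_gt0 ?exprn_gt0//; lra.
exists (entropy_const R d); split => // S eta _ eta0 eta_le a.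
have [a1 aL ca] := radius_facts d_ge1 eta0 eta_le; rewrite -/a in a1 aL ca.
have [eta_ge|eta_lt] := leP (3 / 4) eta.
  have d1 : d = 1%N.
    apply/eqP; rewrite eqn_leq d_ge1 andbT leqNgt; apply/negP => d2.
    by have := eta_lt_dim_ge2 d2 eta_le; lra.
  have rhs0 : (0 <= (entropy_const R d)%:E *
      euclidean_covering_number a (enlargement S a) * (`|ln eta| ^+ d.+1)%:E)%E.
    rewrite !mule_ge0 ?lee_fin ?exprn_ge0 ?(ltW C0)//.
    by apply: le_ereal_inf_tmp => _ [n _ <-]; rewrite lee_fin.
  have [h1 h2] : (lne (covering_number eta (mixtures R d)
      (fun f g => supnorm S (f \- g)%R)) <= 0)%E /\
    (lne (covering_number eta (mixtures R d)
      (fun f g => grad_supnorm S (f \- g)%R)) <= 0)%E.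
    clear -d1 eta_ge; subst d; exact: entropy_dim1_le0.
  by split; [exact: le_trans h1 rhs0|exact: le_trans h2 rhs0].
have L4 : 4^-1 <= - ln eta.
  have := @le_ln1Dx R (eta - 1); rewrite [1 + _]addrC subrK.
  by move=> /(_ ltac:(lra)); lra.
have -> : `|ln eta| = - ln eta by rewrite ltr0_norm//; lra.
have L0 : 0 < - ln eta by lra.
have aL10 : a ^+ 2 <= 10 * - ln eta by lra.
have a0 : 0 <= a by lra.
have inf_le X : (forall N (c : 'I_N -> 'rV[R]_d),
    enlargement S a `<=` \bigcup_(i in [set: 'I_N]) closed_eball (c i) a ->
    (X <= (entropy_const R d * N%:R * (- ln eta) ^+ d.+1)%:E)%E) ->
    (X <= (entropy_const R d)%:E *
      euclidean_covering_number a (enlargement S a) * ((- ln eta) ^+ d.+1)%:E)%E.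
  (* Dividing by the positive real factor turns the claim into a lower bound
     for the infimum over all coverings, which also handles the case where
     there is none. *)
  move=> XN; rewrite muleAC -EFinM.
  have P0 : 0 < entropy_const R d * (- ln eta) ^+ d.+1.
    by rewrite mulr_gt0// exprn_gt0.
  rewrite -lee_pdivrMl//; apply: le_ereal_inf_tmp => _ [N [c cN] <-].
  rewrite lee_pdivrMl// -EFinM mulrAC; exact: XN cN.
have SN N (c : 'I_N -> 'rV[R]_d) (cN : enlargement S a `<=`
    \bigcup_(i in [set: 'I_N]) closed_eball (c i) a) :=
  entropy_le d_ge1 a1 eta0 L4 aL10 (subset_trans (sub_enlargement a0) cN) ca.
by split; apply: inf_le => N c /SN [].
Qed.
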